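(* There is an absolute constant $k_0$ such that the following holds for every integer $k\ge k_0$. Let $m\ge 2$ and $d\ge 1$ be integers, and let $A=(a_{ij})$ be an $m\times d$ integer matrix such that $|a_{ij}|\le k$ for all $i,j$ and all $m\times m$ submatrices of $A$ have full rank. Then $$d\le 100\,k\sqrt{\log k}\; m \quad\text{if } m\ge \log k,$$ and $$d\le 400\,k^{m/(m-1)}\,m^{3/2}\quad\text{if } 2\le m<\log k.$$
   Context: All logarithms are to base $e$. An $m\times m$ submatrix of an $m\times d$ matrix $A$ is the matrix formed by choosing $m$ distinct columns of $A$; full rank means that it is non-degenerate (nonzero determinant). *)

(* Defs.v *)
From mathcomp Require Import all_boot all_order all_algebra.

Set Implicit Arguments.
Unset Strict Implicit.
Unset Printing Implicit Defensive.

Local Open Scope ring_scope.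

(* An injective [f] chooses [m] distinct columns, in the order given by [f];
   reordering them only changes the sign of the determinant. *)
Definition all_submx_full_rank (m d : nat) (A : 'M[int]_(m, d)) : Prop :=
  forall f : 'I_m -> 'I_d, injective f -> \det (colsub f A) != 0.

(* Main.v *)
Require Import Defs.
From mathcomp Require Import all_boot all_order all_algebra.
From mathcomp Require Import zify ring lra.
From mathcomp Require Import reals sequences exp.

Set Implicit Arguments.
Unset Strict Implicit.
Unset Printing Implicit Defensive.

(** Why the theorem holds.  If some nonzero integer row vector annihilates [m]
    distinct columns of [A], these columns form a singular submatrix.  So under
    the rank hypothesis every nonzero integer combination of the rows of [A]
    has fewer than [m] zero entries ([zero_columns_lt]), and it suffices to
    find a combination with about [d / (k L sqrt t)] zeros.

    Such a combination is found among the differences of the vectors [c] of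
    the box [{-h, ..., h}^t], which act on the first [t <= m] rows; put
    [L = 2 h + 1] and [N = L ^ t], the number of vectors in the box.  For a
    fixed column [a], the value [c . a] of a uniformly random [c] has mean 0
    and variance at most [t (k h)^2], because the coordinates of [c] are
    uncorrelated ([box_second_moment]).  By Chebyshev, three quarters of the
    box land in a window of [O(k L sqrt t)] integers, and by Cauchy-Schwarz at
    least [N^2 / (4 k L sqrt t)] ordered pairs [(c, c')] take the same value on
    [a] ([collisions_of_second_moment]).  Sum over the [d] columns: the pairs
    with [c = c'] account for only [d N] of the coincidences, and every other
    pair for fewer than [m], since [c - c'] is a nonzero combination
    ([collision_average]).  As soon as the box is so large that the diagonal
    takes up at most half of the total, that is [N >= 8 k L sqrt t], this gives
    [d <= 8 k L sqrt t m] ([column_bound]).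

    It remains to choose [t] and [L].  If [m >= log k], a box of constant side
    [L = 9] in dimension [t = floor (log k)] is large enough, since [9 > e^2]
    makes [N] of order at least [k^2] ([column_bound_tall]).  For smaller [m]
    all rows are used, [t = m], and the side has to grow like [k^(1/(m-1))]
    ([column_bound_short]). *)

Import Order.TTheory GRing.Theory Num.Theory.

Local Open Scope ring_scope.

(** * Coincidences of an integer-valued function *)

(** Cauchy-Schwarz against the constant function 1. *)
Lemma sqr_sum_le_card (I : finType) (F : I -> nat) :
  ((\sum_i F i) ^ 2 <= #|I| * \sum_i F i ^ 2)%N.
Proof.
have dbl : (2 * (\sum_i F i) ^ 2 <= 2 * (#|I| * \sum_i F i ^ 2))%N.
  have -> : ((\sum_i F i) ^ 2 = \sum_i \sum_j F i * F j)%N.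
    by rewrite -mulnn big_distrlr.
  have -> : (2 * (#|I| * \sum_i F i ^ 2) =
             \sum_i \sum_j (F i ^ 2 + F j ^ 2))%N.
    under [RHS]eq_bigr => i _ do rewrite big_split /= sum_nat_const.
    by rewrite big_split /= sum_nat_const -big_distrr /= addnn mul2n.
  rewrite big_distrr; apply: leq_sum => i _ /=.
  by rewrite big_distrr; apply: leq_sum => j _; apply: nat_Cauchy.
by rewrite leq_pmul2l in dbl.
Qed.

(** The right-hand double sum adds up the squared sizes of the fibres of [f]
    on [P]; by Cauchy-Schwarz it is smallest when the fibres are equal. *)
Lemma card_sqr_le_collisions (T I : finType) (P : pred T) (f : T -> I) :
  (#|P| ^ 2 <=
     #|I| * \sum_x \sum_y (P x && P y && (f x == f y) : nat))%N.
Proof.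
have fibres : #|P| = (\sum_i \sum_x (P x && (f x == i) : nat))%N.
  rewrite exchange_big /= -sum1_card big_mkcond /=; apply: eq_bigr => x _.
  rewrite (bigD1 (f x)) //= eqxx andbT big1 ?addn0 => [|i /negPf nfi].
    by rewrite unfold_in; case: (P x).
  by rewrite eq_sym nfi andbF.
have -> : (\sum_x \sum_y (P x && P y && (f x == f y) : nat) =
           \sum_i (\sum_x (P x && (f x == i) : nat)) ^ 2)%N.
  under [RHS]eq_bigr => i _ do rewrite -mulnn big_distrlr.
  rewrite [RHS]exchange_big /=; apply: eq_bigr => x _.
  rewrite [RHS]exchange_big /=; apply: eq_bigr => y _.
  rewrite (bigD1 (f x)) //= eqxx andbT big1 ?addn0 => [|i /negPf nfi].
    by rewrite [f y == _]eq_sym; case: (P x); case: (P y); case: eqP.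
  by rewrite [f x == _]eq_sym nfi andbF.
by rewrite fibres; apply: sqr_sum_le_card.
Qed.

(** Chebyshev: when [M] is at least twice the root mean square of [X], at least
    three quarters of [T] are mapped into [{-M, ..., M}].  The factor 9/16 is
    the square of that proportion. *)
Lemma collisions_of_second_moment (T : finType) (X : T -> int) (M : nat) :
  (0 < M)%N -> 4 * \sum_x X x ^+ 2 <= (#|T| * M ^ 2)%N%:Z ->
  (9 * #|T| ^ 2 <= 16 * (M.*2.+1 * \sum_x \sum_y ((X x == X y)%R : nat)))%N.
Proof.
move=> M0 moment.
pose P := [pred x | `|X x| <= M%:Z].
pose f x : 'I_(M.*2.+1) := inord (absz (X x + M%:Z)).
have markov : (3 * #|T| <= 4 * #|P|)%N.
  have split_card := cardC P.
  have tail : (#|[predC P]| * M ^ 2)%N%:Z <= \sum_x X x ^+ 2.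
    rewrite PoszM -sum1_card (big_morph Posz PoszD (erefl _)) mulr_suml.
    rewrite big_mkcond /=; apply: ler_sum => x _.
    case: ifP => [|_]; last by rewrite sqr_ge0.
    by rewrite !inE; nia.
  rewrite -split_card in moment *.
  have : (4 * (#|[predC P]| * M ^ 2) <= (#|P| + #|[predC P]|) * M ^ 2)%N.
    by rewrite -lez_nat; apply: le_trans moment; rewrite PoszM ler_pM2l.
  by rewrite mulnA leq_pmul2r ?expn_gt0 ?M0 //; move: #|P| #|[predC P]| => a b; lia.
have count := card_sqr_le_collisions P f.
rewrite card_ord in count.
have le_coll : (\sum_x \sum_y (P x && P y && (f x == f y) : nat) <=
                \sum_x \sum_y ((X x == X y)%R : nat))%N.
  apply: leq_sum => x _; apply: leq_sum => y _.
  case: (boolP (P x && P y)) => [/andP[Px Py]|//].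
  case: (f x =P f y) => [eqf|//].
  move: Px Py (congr1 (@nat_of_ord _) eqf) => /=; rewrite /f => Px Py.
  rewrite !inordK; [move=> {}eqf|lia|lia].
  suff -> : X x = X y by rewrite eqxx.
  by lia.
have sqr_markov : (9 * #|T| ^ 2 <= 16 * #|P| ^ 2)%N.
  by rewrite -[9%N]/(3 ^ 2)%N -[16%N]/(4 ^ 2)%N -!expnMn leq_exp2r.
apply: leq_trans sqr_markov _; rewrite leq_pmul2l //.
by apply: leq_trans count _; rewrite leq_pmul2l.
Qed.

(** * Vectors of a box centred at the origin *)

(** A vector of [{-h, ..., h}^t] is coded by a function into the ordinals below
    [2 h + 1], which makes the box a finite type and turns negation of a
    coordinate into [rev_ord]. *)
Definition box_vec (t h : nat) (c : {ffun 'I_t -> 'I_(h.*2.+1)}) : 'rV[int]_t :=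
  \row_i ((c i)%:Z - h%:Z).

Lemma box_vec_inj (t h : nat) : injective (@box_vec t h).
Proof.
move=> c c' /rowP eqcc'; apply/ffunP => i; apply: val_inj.
by have := eqcc' i; rewrite !mxE /=; lia.
Qed.

(** Changing the sign of the [i]-th coordinate permutes the box and negates
    the sum. *)
Lemma box_vec_orthogonal (t h : nat) (i j : 'I_t) : i != j ->
  \sum_(c : {ffun 'I_t -> 'I_(h.*2.+1)}) box_vec c 0 i * box_vec c 0 j = 0.
Proof.
move=> nij; set S := LHS.
pose flip (c : {ffun 'I_t -> 'I_(h.*2.+1)}) : {ffun 'I_t -> 'I_(h.*2.+1)} :=
  [ffun l => if l == i then rev_ord (c l) else c l].
have flipK : involutive flip.
  by move=> c; apply/ffunP => l; rewrite !ffunE; case: eqP; rewrite ?rev_ordK.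
suff : S = - S by lia.
rewrite {1}/S (reindex_inj (inv_inj flipK)) /S -sumrN; apply: eq_bigr => c _.
rewrite !mxE !ffunE eqxx [j == i]eq_sym (negPf nij) -mulNr; congr (_ * _).
by case: (c i) => x /= ltx; lia.
Qed.

(** The variance of a sum of uncorrelated terms is the sum of their variances,
    and each term is bounded by [k h] in absolute value. *)
Lemma box_second_moment (t h k : nat) (a : 'cV[int]_t) :
  (forall i, `|a i 0| <= k%:Z) ->
  \sum_(c : {ffun 'I_t -> 'I_(h.*2.+1)}) ((box_vec c *m a) 0 0) ^+ 2 <=
    (h.*2.+1 ^ t * (t * (k * h) ^ 2))%N%:Z.
Proof.
move=> ak.
have -> : \sum_(c : {ffun 'I_t -> 'I_(h.*2.+1)}) ((box_vec c *m a) 0 0) ^+ 2 =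
  \sum_i \sum_(c : {ffun 'I_t -> 'I_(h.*2.+1)}) (box_vec c 0 i * a i 0) ^+ 2.
  under eq_bigr => c _ do rewrite mxE expr2 big_distrlr /=.
  rewrite exchange_big; apply: eq_bigr => i _ /=.
  rewrite exchange_big (bigD1 i) //= [X in _ + X]big1 ?addr0 => [|j nji].
    by apply: eq_bigr => c _; rewrite expr2.
  under eq_bigr => c _ do rewrite mulrACA.
  by rewrite -mulr_suml box_vec_orthogonal ?mul0r // eq_sym.
have card_box : #|{: {ffun 'I_t -> 'I_(h.*2.+1)}}| = (h.*2.+1 ^ t)%N.
  by rewrite card_ffun !card_ord.
rewrite -card_box.
apply: le_trans (_ : \sum_(i < t)
  (#|{: {ffun 'I_t -> 'I_(h.*2.+1)}}| * (k * h) ^ 2)%N%:Z <= _); last first.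
  by rewrite sumr_const card_ord; lia.
apply: ler_sum => i _.
rewrite PoszM -sum1_card (big_morph Posz PoszD (erefl _)) mulr_suml.
apply: ler_sum => c _; rewrite mul1r exprMn.
have xh : `|box_vec c 0 i| <= h%:Z by rewrite mxE; case: (c i) => x /= ltx; lia.
have x2 : box_vec c 0 i ^+ 2 <= h%:Z ^+ 2 by rewrite -real_normK ?num_real ?lerXn2r ?nnegrE.
have a2 : a i 0 ^+ 2 <= k%:Z ^+ 2 by rewrite -real_normK ?num_real ?lerXn2r ?nnegrE.
have -> : ((k * h) ^ 2)%N%:Z = h%:Z ^+ 2 * k%:Z ^+ 2.
  by rewrite -mulnn !PoszM; ring.
by apply: ler_pM x2 a2; apply: sqr_ge0.
Qed.

(** * The averaging argument *)

(** A combination of the first [t] rows with [m] zero entries would give a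
    nonzero vector in the left kernel of a nonsingular [m] by [m] submatrix. *)
Lemma zero_columns_lt (m d t : nat) (A : 'M[int]_(m, d)) (let_m : (t <= m)%N)
    (v : 'rV[int]_t) :
  all_submx_full_rank A -> v != 0 ->
  (\sum_j (((v *m rowsub (widen_ord let_m) A) 0 j == 0)%R : nat) < m)%N.
Proof.
move=> fullA v0; rewrite ltnNge; apply/negP => many.
pose Z := [pred j | (v *m rowsub (widen_ord let_m) A) 0 j == 0].
have mZ : (m <= #|Z|)%N.
  apply: leq_trans many _; rewrite -sum1_card [leqRHS]big_mkcond /=.
  by apply: leq_sum => j _; rewrite inE; case: eqP.
pose f i : 'I_d := enum_val (widen_ord mZ i).
have f_inj : injective f.
  by move=> i i' /enum_val_inj /(congr1 (@nat_of_ord _)) /=; apply: val_inj.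
pose B := colsub f A.
(* [w] is [v] followed by zeros: the same combination, of all the rows. *)
pose w : 'rV[int]_m := v *m rowsub (widen_ord let_m) 1%:M.
have wB : w *m B = 0.
  rewrite -mulmxA mul_rowsub_mx mul1mx /B.
  apply/rowP => j; have /eqP := enum_valP (widen_ord mZ j).
  rewrite -/(f j) !mxE => vZ; rewrite -[RHS]vZ.
  by apply: eq_bigr => i _; rewrite !mxE.
have w0 : w = 0.
  have : \det B *: w = 0 by rewrite -mul_mx_scalar -mul_mx_adj mulmxA wB mul0mx.
  move=> /rowP detBw; apply/rowP => i; have /eqP := detBw i.
  by rewrite !mxE mulf_eq0 (negPf (fullA f f_inj)) => /eqP.
case/eqP: v0; apply/rowP => i; have /rowP/(_ (widen_ord let_m i)) := w0.
rewrite !mxE => <-; rewrite (bigD1 i) //= big1 ?addr0 => [|l nli].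
  by rewrite !mxE eqxx mulr1.
by rewrite !mxE -val_eqE /= val_eqE (negPf nli) mulr0.
Qed.

(** Double counting of the triples [(c, c', j)] such that the box vectors [c]
    and [c'] take the same value on column [j].  The condition on [M] says that
    it is at least twice the standard deviation bound [sqrt t k h]. *)
Lemma collision_average (m d t h k M : nat) (A : 'M[int]_(m, d)) :
    (t <= m)%N -> (0 < M)%N -> (4 * (t * (k * h) ^ 2) <= M ^ 2)%N ->
    (forall i j, `|A i j| <= k%:Z) -> all_submx_full_rank A ->
  (9 * (d * h.*2.+1 ^ t) <= 16 * (M.*2.+1 * (d + h.*2.+1 ^ t * m)))%N.
Proof.
move=> let_m M0 leM Ak fullA.
pose T := {ffun 'I_t -> 'I_(h.*2.+1)}.
have <- : #|{: T}| = (h.*2.+1 ^ t)%N by rewrite card_ffun !card_ord.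
set N := #|{: T}|.
have N0 : (0 < N)%N by rewrite /N card_ffun !card_ord expn_gt0.
pose B := rowsub (widen_ord let_m) A.
pose X j (c : T) : int := (box_vec c *m B) 0 j.
have col_coll j :
    (9 * N ^ 2 <= 16 * (M.*2.+1 * \sum_c \sum_c' ((X j c == X j c')%R : nat)))%N.
  apply: collisions_of_second_moment => //.
  have /box_second_moment-/(_ h) : forall i, `|col j B i 0| <= k%:Z.
    by move=> i; rewrite !mxE.
  have -> : \sum_(c : T) ((box_vec c *m col j B) 0 0) ^+ 2 = \sum_(c : T) X j c ^+ 2.
    apply: eq_bigr => c _; congr (_ ^+ 2); rewrite /X !mxE.
    by apply: eq_bigr => i _; rewrite [col _ _ _ _]mxE.
  have -> : (h.*2.+1 ^ t)%N = N by rewrite /N card_ffun !card_ord.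
  move=> moment; apply: le_trans (_ : 4 * (N * (t * (k * h) ^ 2))%N%:Z <= _).
    by rewrite ler_pM2l.
  by rewrite -PoszM lez_nat mulnCA leq_pmul2l.
have pair_coll c c' :
    (\sum_j ((X j c == X j c')%R : nat) <= (c == c') * d + m)%N.
  case: eqP => [_|/eqP ncc'].
    rewrite mul1n -[d in (d + _)%N]card_ord -sum1_card.
    by apply: leq_trans (leq_addr _ _); apply: leq_sum => j _; case: eqP.
  apply: ltnW; rewrite mul0n add0n.
  have := @zero_columns_lt m d t A let_m (box_vec c - box_vec c') fullA.
  rewrite subr_eq0 (inj_eq (@box_vec_inj t h)) => /(_ ncc').
  congr (_ < m)%N; apply: eq_bigr => j _.
  by rewrite mulmxBl [in LHS]mxE [X in _ + X]mxE subr_eq0.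
have total : (\sum_j \sum_c \sum_c' ((X j c == X j c')%R : nat) <=
              N * (d + N * m))%N.
  rewrite exchange_big /= -[N in (N * (d + _))%N]sum1_card big_distrl /=.
  apply: leq_sum => c _; rewrite exchange_big mul1n /=.
  apply: leq_trans (leq_sum _ (fun c' _ => pair_coll c c')) _.
  rewrite big_split /= sum_nat_const leq_add2r -big_distrl /=.
  rewrite (bigD1 c) //= eqxx big1 ?addn0 ?mul1n // => c' /negPf.
  by rewrite eq_sym => ->.
have sum_coll : (d * (9 * N ^ 2) <= 16 * (M.*2.+1 * (N * (d + N * m))))%N.
  have := leq_sum (index_enum 'I_d) (fun j (_ : true) => col_coll j).
  rewrite sum_nat_const card_ord -!big_distrr /= => /leq_trans; apply.
  by rewrite !leq_pmul2l.
by rewrite -(leq_pmul2l N0); nia.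
Qed.

(** Here [q] bounds the half-width of the window from above, up to rounding.
    The hypothesis makes the contribution of the pairs [c = c'] at most half
    of all coincidences, so that it can be absorbed. *)
Lemma column_bound (R : realType) (m d t h k : nat) (A : 'M[int]_(m, d)) :
    (1 <= t <= m)%N -> (4 <= k)%N ->
    (forall i j, `|A i j| <= k%:Z) -> all_submx_full_rank A ->
  let q : R := k%:R * h.*2.+1%:R * Num.sqrt t%:R in
  8 * q <= h.*2.+1%:R ^+ t -> d%:R <= 8 * q * m%:R.
Proof.
move=> /andP[t1 let_m] k4 Ak fullA q le_qN.
set s : R := Num.sqrt t%:R in q le_qN *.
have s1 : 1 <= s by rewrite -[1]sqrtr1 ler_sqrt ?ltr01 ?ler0n // ler1n.
have s2 : s ^+ 2 = t%:R by rewrite sqr_sqrtr ?ler0n.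
have k4R : (4 : R) <= k%:R by rewrite ler_nat.
have h0 : (0 : R) <= h%:R by rewrite ler0n.
have LE : (h.*2.+1%:R : R) = 2 * h%:R + 1 by rewrite -natr1 -mul2n natrM.
(* [y] is twice the standard deviation bound; it is rounded up to [M], and
   the slack [q - y = k s >= 4] pays for the rounding. *)
pose y : R := 2 * h%:R * k%:R * s.
have ks4 : 4 <= k%:R * s by nra.
have y0 : 0 <= y by rewrite /y !mulr_ge0 //; lra.
have qE : q = y + k%:R * s by rewrite /q /y LE; ring.
have /andP[] := truncn_itv y0; set M := (Num.truncn y).+1 => leMy ltyM.
have MR : (M%:R : R) <= y + 1 by rewrite /M -natr1 lerD2r.
have leM : (4 * (t * (k * h) ^ 2) <= M ^ 2)%N.
  rewrite -(ler_nat R) natrX !natrM -s2.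
  rewrite (_ : 4 * _ = y ^+ 2); last by rewrite /y; ring.
  by rewrite lerXn2r ?nnegrE ?ler0n // ltW.
have ME : (M.*2.+1%:R : R) = 2 * M%:R + 1 by rewrite -natr1 -mul2n natrM.
have := collision_average let_m (ltn0Sn _) leM Ak fullA.
rewrite -(ler_nat R) !natrM natrD natrM natrX ME.
set N : R := _ ^+ t in le_qN *.
have d0 : 0 <= d%:R :> R by rewrite ler0n.
have m0 : 0 <= m%:R :> R by rewrite ler0n.
have q4 : 4 <= q by lra.
have N0 : 0 < N by lra.
set S := (d%:R + _) => avg.
have S0 : 0 <= S by rewrite /S addr_ge0 // mulr_ge0 // ltW.
have {}avg : d%:R * N <= 4 * q * S.
  have : (2 * M%:R + 1) * S <= (9 / 4 * q) * S by rewrite ler_wpM2r //; lra.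
  lra.
have half : 8 * q * d%:R <= N * d%:R by rewrite ler_wpM2r.
rewrite -(ler_pM2r N0); rewrite /S in avg; lra.
Qed.

(** * Choice of the box *)

(** [1 - 1/6 <= exp (- 1/6)] gives [e <= (6/5)^6 < 3]. *)
Lemma expR1_le3 (R : realType) : expR 1 <= 3 :> R.
Proof.
have e6 : expR (6^-1) <= 6 / 5 :> R.
  have := @expR_ge1Dx R (- 6^-1); rewrite expRN => le_inv.
  have e0 := expR_gt0 (6^-1 : R).
  have : 5 / 6 * expR 6^-1 <= (expR 6^-1)^-1 * expR 6^-1 :> R.
    by rewrite ler_pM2r //; lra.
  by rewrite mulVf ?gt_eqF //; lra.
rewrite (_ : expR 1 = expR (6%:R * 6^-1)); last by congr expR; lra.
rewrite expRM_natl; apply: le_trans (lerXn2r 6 _ _ e6) _.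
- by rewrite nnegrE expR_ge0.
- by rewrite nnegrE; lra.
- lra.
Qed.

(** This is [9 >= e^2] raised to the power [floor (ln x) + 1 > ln x]. *)
Lemma sqr_le_pow9_truncn_ln (R : realType) (x : R) : 1 <= x ->
  x ^+ 2 <= 9 ^+ (Num.truncn (ln x)).+1.
Proof.
move=> x1; have x0 : 0 < x by lra.
have /andP[_ /ltW lt_ln] := truncn_itv (ln_ge0 x1).
have -> : 9 = 3 ^+ 2 :> R by ring.
rewrite exprAC lerXn2r ?nnegrE ?exprn_ge0 //; first exact: ltW.
rewrite -[x in x <= _]lnK ?posrE //.
apply: le_trans (_ : expR (Num.truncn (ln x)).+1%:R <= _).
  by rewrite ler_expR.
rewrite -[_%:R]mulr1 expRM_natl lerXn2r ?nnegrE ?expR_ge0 //.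
exact: expR1_le3.
Qed.

(** With [h = 4] and [t = floor (ln k)] the box has at least [k^2 / 9] points,
    which exceeds the required [72 k sqrt t] because [sqrt t <= sqrt k] is far
    below [k / 648] for large [k]. *)
Lemma column_bound_tall (R : realType) (m d k : nat) (A : 'M[int]_(m, d)) :
    (10 ^ 6 <= k)%N -> (forall i j, `|A i j| <= k%:Z) ->
    all_submx_full_rank A -> ln (k%:R : R) <= m%:R ->
  (d%:R : R) <= 100 * k%:R * Num.sqrt (ln k%:R) * m%:R.
Proof.
move=> k_big Ak fullA le_lnm; set x : R := k%:R.
have x_big : 10 ^+ 6 <= x by rewrite -natrX ler_nat.
have sqrt_x_big : 10 ^+ 3 <= Num.sqrt x.
  by rewrite -[10 ^+ 3]ger0_norm ?exprn_ge0 // -sqrtr_sqr ler_wsqrtr // -exprM.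
have k4 : (4 <= k)%N by apply: leq_trans k_big.
clear k_big x_big; have sqr_x : Num.sqrt x ^+ 2 = x by rewrite sqr_sqrtr.
have x4 : 4 <= x by nra.
have x1 : 1 <= x by lra.
have ln0 : 0 <= ln x by apply: ln_ge0.
have ln1 : 1 <= ln x.
  rewrite -ler_expR lnK ?posrE; last by lra.
  by have := expR1_le3 R; lra.
have pow9 := sqr_le_pow9_truncn_ln x1.
have t1 : (1 <= Num.truncn (ln x))%N by rewrite truncn_gt0.
have /andP[le_t _] := truncn_itv ln0.
move: pow9 t1 le_t; move: (Num.truncn (ln x)) => t pow9 t1 le_t.
have let_m : (t <= m)%N by rewrite -(ler_nat R); apply: le_trans le_lnm.
have sqrt_t : Num.sqrt t%:R <= Num.sqrt (ln x) by rewrite ler_wsqrtr.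
have sqrt_x : Num.sqrt t%:R <= Num.sqrt x.
  apply: le_trans sqrt_t _; rewrite ler_wsqrtr //.
  by apply/ltW/ln_sublinear; lra.
have bound := @column_bound R m d t 4 k A _ _ Ak fullA.
apply: le_trans (bound _ _ _) _.
- by rewrite t1.
- exact: k4.
- rewrite -/x -[4.*2.+1]/9%N; move: pow9; rewrite [9 ^+ _.+1]exprS => pow9.
  have le_sx : 9 ^+ 2 * 8 * Num.sqrt t%:R <= x by nra.
  have : x * (9 ^+ 2 * 8 * Num.sqrt t%:R) <= x * x by rewrite ler_wpM2l //; lra.
  by lra.
- rewrite -/x -[4.*2.+1]/9%N ler_wpM2r //.
  have : x * Num.sqrt t%:R <= x * Num.sqrt (ln x) by rewrite ler_wpM2l //; lra.
  have : 0 <= x * Num.sqrt t%:R by rewrite mulr_ge0 ?sqrtr_ge0 //; lra.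
  by lra.
Qed.

(** With [u = k^(1/(m-1))], the side [L] is taken between [16 u] and
    [16 u + 3 <= 19 u].  Then [L^(m-1) >= 16^(m-1) k >= 8 k sqrt m], so the box
    is large enough, and [8 L <= 152 u] yields the constant. *)
Lemma column_bound_short (R : realType) (m d k : nat) (A : 'M[int]_(m, d)) :
    (4 <= k)%N -> (2 <= m)%N -> (forall i j, `|A i j| <= k%:Z) ->
    all_submx_full_rank A ->
  (d%:R : R) <= 400 * (k%:R `^ (m%:R / (m%:R - 1))) * (m%:R `^ (3 / 2)).
Proof.
case: m A => [|[|n]] // A k4 _ Ak fullA; set m := n.+2; set x : R := k%:R.
have x4 : 4 <= x by rewrite ler_nat.
have x0 : 0 < x by lra.
have n1E : m%:R - 1 = n.+1%:R :> R by rewrite -[m%:R]natr1 addrK.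
have n10 : n.+1%:R != 0 :> R by rewrite pnatr_eq0.
pose u := x `^ n.+1%:R^-1.
have u0 : 0 <= u by apply: powR_ge0.
have uX : u ^+ n.+1 = x.
  by rewrite -powR_mulrn // -powRrM mulVf // powRr1 //; lra.
have u1 : 1 <= u.
  by rewrite -(@ler_pXn2r _ n.+1) ?nnegrE // expr1n uX; lra.
have -> : x `^ (m%:R / (m%:R - 1)) = x * u.
  have -> : m%:R / (m%:R - 1) = 1 + n.+1%:R^-1 :> R.
    by rewrite n1E -[m%:R]natr1 mulrDl mulfV // mul1r.
  by rewrite powRD ?(gt_eqF x0) ?implybT // powRr1 // ltW.
have -> : m%:R `^ (3 / 2) = m%:R * Num.sqrt m%:R :> R.
  have -> : 3 / 2 = 1 + 2^-1 :> R by lra.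
  by rewrite powRD ?pnatr_eq0 ?implybT // powRr1 // powR12_sqrt.
have /andP[] := @truncn_itv R (8 * u) ltac:(lra).
set h := (Num.truncn (8 * u)).+1 => le_h lt_h.
have hR : (h%:R : R) <= 8 * u + 1 by rewrite /h -natr1 lerD2r.
have LE : (h.*2.+1%:R : R) = 2 * h%:R + 1 by rewrite -natr1 -mul2n natrM.
set s : R := Num.sqrt m%:R.
have s0 : 0 <= s by apply: sqrtr_ge0.
have s2 : s ^+ 2 = m%:R by rewrite sqr_sqrtr.
have s_le : s <= m%:R.
  have : 1 <= s by rewrite -[1]sqrtr1 ler_wsqrtr // ler1n.
  by rewrite -s2; nra.
have pow16 : 8 * m%:R <= 16 ^+ n.+1 :> R.
  rewrite -natrX -natrM ler_nat /m.
  by elim: (n) => [//|p IHp]; rewrite expnS; lia.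
have bound := @column_bound R m d m h k A _ k4 Ak fullA.
apply: le_trans (bound _ _) _.
- by rewrite leqnn.
- rewrite -/x -/s exprS.
  have le_pow : 16 ^+ n.+1 * x <= h.*2.+1%:R ^+ n.+1.
    by rewrite -uX -exprMn lerXn2r ?nnegrE ?ler0n //; rewrite ?LE; lra.
  have L0 : (0 : R) <= h.*2.+1%:R by rewrite ler0n.
  rewrite (_ : 8 * _ = h.*2.+1%:R * (8 * s * x)); last by ring.
  rewrite ler_wpM2l //; apply: le_trans le_pow.
  by rewrite ler_wpM2r //; lra.
- rewrite -/x -/s (_ : 400 * _ * _ = 400 * u * (x * s * m%:R)); last by ring.
  rewrite (_ : 8 * _ * _ = 8 * h.*2.+1%:R * (x * s * m%:R)); last by ring.
  rewrite ler_wpM2r ?LE //; last by lra.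
  by rewrite !mulr_ge0 //; lra.
Qed.

Theorem theorem1p2 :
  exists k0 : nat,
  forall (R : realType) (k : nat), (k0 <= k)%N ->
  forall (m d : nat) (A : 'M[int]_(m, d)),
    (2 <= m)%N -> (1 <= d)%N ->
    (forall (i : 'I_m) (j : 'I_d), `|A i j| <= k%:Z) ->
    all_submx_full_rank A ->
    (ln (k%:R : R) <= m%:R ->
       (d%:R : R) <= 100 * k%:R * Num.sqrt (ln k%:R) * m%:R) /\
    (m%:R < ln (k%:R : R) ->
       (d%:R : R) <= 400 * (k%:R `^ (m%:R / (m%:R - 1))) * (m%:R `^ (3 / 2))).
Proof.
exists (10 ^ 6)%N => R k k_big m d A m2 _ Ak fullA; split=> [le_lnm|_].
  exact: column_bound_tall.
apply: column_bound_short => //.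
by apply: leq_trans k_big.
Qed.
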